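(* Let $F$ be an algebraically closed field of characteristic $0$, let $n\ge2$, $\Omega=\{1,\dots,n\}$, and let $\mathfrak{A}$ be the universal associative envelope of the anti-Jordan triple system of all $n\times n$ matrices over $F$, with generators $e_{i,j}$. For all $i,j,k,\ell\in\Omega$ the following identities hold in $\mathfrak{A}$. (1) If $\ell\ne1$: $\;e_{i,j}\cdot e_{1,k}e_{1,1}e_{\ell,1}=\delta_{i,k}\big[-e_{1,j}e_{\ell,1}+\widehat\delta_{j,1}\delta_{j,\ell}\tfrac12(e_{1,1}^4+e_{1,1}^2)\big].$ (2) $$e_{i,j}\cdot e_{1,1}^2e_{1,k}=\delta_{j,1}\Big[\delta_{i,1}\big(\delta_{k,1}e_{1,1}^4+\widehat\delta_{k,1}e_{1,1}e_{1,k}\big)+\widehat\delta_{i,1}\big(\delta_{i,k}\tfrac12(e_{1,1}^4-e_{1,1}^2)+e_{i,1}e_{1,k}\big)\Big]-\widehat\delta_{j,1}\delta_{i,1}\delta_{k,1}e_{1,j}e_{1,1}.$$ (3) $$e_{i,j}\cdot e_{1,1}^4=\delta_{j,1}\big[\delta_{i,1}e_{1,1}+\widehat\delta_{i,1}(e_{1,1}^2e_{i,1}+e_{i,1})\big]-\widehat\delta_{j,1}\delta_{i,1}(e_{1,1}^2e_{1,j}-e_{1,j}).$$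
   Context: $\delta_{i,j}$ is the Kronecker delta and $\widehat\delta_{i,j}=1-\delta_{i,j}$. The anti-Jordan triple system of all $n\times n$ matrices over $F$ has trilinear product $\langle a,b,c\rangle=abc-cba$. Its universal associative envelope is $\mathfrak{A}=F\langle X\rangle/I$, where $F\langle X\rangle$ is the free unital associative algebra on symbols $X=\{e_{i,j}\}_{i,j\in\Omega}$ (with $e_{i,j}$ corresponding to the matrix unit $E_{i,j}$), and $I$ is the two-sided ideal generated by all elements $e_{i,j}e_{k,\ell}e_{m,t}-e_{m,t}e_{k,\ell}e_{i,j}-\delta_{j,k}\delta_{\ell,m}e_{i,t}+\delta_{t,k}\delta_{\ell,i}e_{m,j}$ for $i,j,k,\ell,m,t\in\Omega$. The image of $e_{i,j}$ in $\mathfrak{A}$ is again denoted $e_{i,j}$. *)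

(* Defs.v *)
From HB Require Import structures.
From mathcomp Require Import all_boot all_algebra.
From mathcomp Require Import generic_quotient ring_quotient.
From mathcomp Require Import boolp.
From mathcomp Require Import monalg.

Set Implicit Arguments.
Unset Strict Implicit.
Unset Printing Implicit Defensive.

Import GRing.Theory.
Local Open Scope ring_scope.
Local Open Scope quotient_scope.

Definition kdelta (R : pzRingType) (I : eqType) (i j : I) : R := (i == j)%:R.
Definition kdeltac (R : pzRingType) (I : eqType) (i j : I) : R :=
  1 - kdelta R i j.

Arguments kdelta {R I} i j.
Arguments kdeltac {R I} i j.

Inductive ideal_gen (R : pzRingType) (S : R -> Prop) : R -> Prop :=
| IdealGen x of S x : ideal_gen S x
| Ideal0 : ideal_gen S 0
| IdealB x y of ideal_gen S x & ideal_gen S y : ideal_gen S (x - y)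
| IdealMl a x of ideal_gen S x : ideal_gen S (a * x)
| IdealMr a x of ideal_gen S x : ideal_gen S (x * a).

Definition in_ideal (R : nzRingType) (S : R -> Prop) : {pred R} :=
  fun x => `[< ideal_gen S x >].

Section QuotientAlgebra.
Variables (F : fieldType) (B : algType F) (S : B -> Prop).
Local Notation I := (in_ideal S).

Fact in_ideal_zmod_closed : zmod_closed I.
Proof.
split=> [|x y /asboolP xI /asboolP yI]; apply/asboolP; first exact: Ideal0.
exact: IdealB.
Qed.

HB.instance Definition _ :=
  GRing.isZmodClosed.Build B I in_ideal_zmod_closed.

Lemma in_idealMl a x : x \in I -> a * x \in I.
Proof. by move/asboolP=> xI; apply/asboolP/IdealMl. Qed.

Lemma in_idealMr a x : x \in I -> x * a \in I.
Proof. by move/asboolP=> xI; apply/asboolP/IdealMr. Qed.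

Lemma in_idealZ (c : F) x : x \in I -> c *: x \in I.
Proof. by move=> xI; rewrite -[x]mul1r scalerAl in_idealMl. Qed.

Hypothesis proper : ~ ideal_gen S 1.

(* B / <S>; properness only serves to equip it with a nontrivial ring. *)
Definition quot_alg of ~ ideal_gen S 1 : Type := Quotient.quot I.
Local Notation Q := (quot_alg proper).

HB.instance Definition _ := GRing.Zmodule.on Q.
HB.instance Definition _ := EqQuotient.on Q.

Definition quot_pi (x : B) : Q := \pi_Q x.

Lemma quot_piP (x y : B) : reflect (quot_pi x = quot_pi y) (x - y \in I).
Proof. by rewrite (Quotient.idealrBE I); apply: eqP. Qed.

Lemma quot_piD : {morph quot_pi : x y / x + y}.
Proof. exact: (Quotient.pi_add I). Qed.

Lemma quot_piK : cancel (repr : Q -> B) quot_pi.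
Proof. exact: reprK. Qed.

Lemma quot_ind (P : Q -> Prop) : (forall x, P (quot_pi x)) -> forall x, P x.
Proof. by move=> Ppi x; rewrite -[x]quot_piK; apply: Ppi. Qed.

Definition quot_one : Q := quot_pi 1.
Definition quot_mul (x y : Q) : Q := quot_pi (repr x * repr y).
Definition quot_scale (c : F) (x : Q) : Q := quot_pi (c *: repr x).

Lemma repr_quot_pi (x : B) : repr (quot_pi x) - x \in I.
Proof. by apply/quot_piP; rewrite quot_piK. Qed.

Lemma quot_piM : {morph quot_pi : x y / x * y >-> quot_mul x y}.
Proof.
move=> x y; apply/esym/quot_piP; set x' := repr _; set y' := repr _.
rewrite -[x' * y' - x * y](subrKA (x * y')) -mulrBl -mulrBr rpredD //.
  by rewrite in_idealMr // repr_quot_pi.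
by rewrite in_idealMl // repr_quot_pi.
Qed.

Lemma quot_piZ (c : F) (x : B) : quot_pi (c *: x) = quot_scale c (quot_pi x).
Proof. by apply/esym/quot_piP; rewrite -scalerBr in_idealZ // repr_quot_pi. Qed.

Fact quot_mulA : associative quot_mul.
Proof.
elim/quot_ind=> x; elim/quot_ind=> y; elim/quot_ind=> z.
by rewrite -!quot_piM mulrA.
Qed.

Fact quot_mul1q : left_id quot_one quot_mul.
Proof. by elim/quot_ind=> x; rewrite -quot_piM mul1r. Qed.

Fact quot_mulq1 : right_id quot_one quot_mul.
Proof. by elim/quot_ind=> x; rewrite -quot_piM mulr1. Qed.

Fact quot_mulDl : left_distributive quot_mul +%R.
Proof.
elim/quot_ind=> x; elim/quot_ind=> y; elim/quot_ind=> z.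
by rewrite -quot_piD -!quot_piM mulrDl quot_piD.
Qed.

Fact quot_mulDr : right_distributive quot_mul +%R.
Proof.
elim/quot_ind=> x; elim/quot_ind=> y; elim/quot_ind=> z.
by rewrite -quot_piD -!quot_piM mulrDr quot_piD.
Qed.

Fact quot_pi0 : quot_pi 0 = 0.
Proof. by apply: (addIr (quot_pi 0)); rewrite -quot_piD !add0r. Qed.

Fact quot_one_neq0 : quot_one != 0.
Proof.
apply/eqP => one0; apply/proper/asboolP.
by rewrite -[1]subr0; apply/quot_piP; rewrite quot_pi0.
Qed.

HB.instance Definition _ := GRing.Zmodule_isNzRing.Build Q
  quot_mulA quot_mul1q quot_mulq1 quot_mulDl quot_mulDr quot_one_neq0.

Fact quot_scaleA a b x : quot_scale a (quot_scale b x) = quot_scale (a * b) x.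
Proof. by elim/quot_ind: x => x; rewrite -!quot_piZ scalerA. Qed.

Fact quot_scale1 : left_id 1 quot_scale.
Proof. by elim/quot_ind=> x; rewrite -quot_piZ scale1r. Qed.

Fact quot_scaleDr : right_distributive quot_scale +%R.
Proof.
move=> c; elim/quot_ind=> x; elim/quot_ind=> y.
by rewrite -quot_piD -!quot_piZ scalerDr quot_piD.
Qed.

Fact quot_scaleDl x : {morph quot_scale^~ x : a b / a + b}.
Proof. by elim/quot_ind: x => x a b; rewrite -!quot_piZ scalerDl quot_piD. Qed.

HB.instance Definition _ := GRing.Zmodule_isLmodule.Build F Q
  quot_scaleA quot_scale1 quot_scaleDr quot_scaleDl.

Fact quot_scaleAl (c : F) (x y : Q) : c *: (x * y) = c *: x * y.
Proof.
elim/quot_ind: x => x; elim/quot_ind: y => y.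
have zE z : quot_pi (c *: z) = c *: quot_pi z by exact: quot_piZ.
have mE : {morph quot_pi : u v / u * v} by exact: quot_piM.
by rewrite -mE -!zE -mE scalerAl.
Qed.

HB.instance Definition _ := GRing.Lmodule_isLalgebra.Build F Q quot_scaleAl.

Fact quot_scaleAr (c : F) (x y : Q) : c *: (x * y) = x * (c *: y).
Proof.
elim/quot_ind: x => x; elim/quot_ind: y => y.
have zE z : quot_pi (c *: z) = c *: quot_pi z by exact: quot_piZ.
have mE : {morph quot_pi : u v / u * v} by exact: quot_piM.
by rewrite -mE -!zE -mE scalerAr.
Qed.

HB.instance Definition _ := GRing.Lalgebra_isAlgebra.Build F Q quot_scaleAr.

Fact quot_pi_zmod_morphism : zmod_morphism quot_pi.
Proof. by move=> x y; rewrite -[in RHS](subrK y x) [in RHS]quot_piD addrK. Qed.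

Fact quot_pi_monoid_morphism : monoid_morphism quot_pi.
Proof. by split=> // x y; apply: quot_piM. Qed.

Fact quot_pi_scalable : scalable quot_pi.
Proof. by move=> c x; apply: quot_piZ. Qed.

HB.instance Definition _ :=
  GRing.isZmodMorphism.Build B Q quot_pi quot_pi_zmod_morphism.
HB.instance Definition _ :=
  GRing.isMonoidMorphism.Build B Q quot_pi quot_pi_monoid_morphism.
HB.instance Definition _ :=
  GRing.isScalable.Build F B Q *:%R quot_pi quot_pi_scalable.

Lemma quot_pi_eq0 (x : B) : ideal_gen S x -> quot_pi x = 0.
Proof.
by move=> Sx; rewrite -quot_pi0; apply/quot_piP; rewrite subr0; apply/asboolP.
Qed.

End QuotientAlgebra.

Lemma malg_scalerAr (K : monomType) (R : comNzRingType) (c : R)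
    (x y : {malg R[K]}) : c *: (x * y) = x * (c *: y).
Proof.
apply/malgP => k; rewrite mcoeffZ.
rewrite (mcoeffMlw (d1 := msupp x) (d2 := msupp y) k) ?fsubset_refl //.
rewrite (mcoeffMlw (d1 := msupp x) (d2 := msupp y) k) ?fsubset_refl ?msuppZ_le //.
rewrite mulr_sumr; apply: eq_bigr => i _.
rewrite mulr_sumr; apply: eq_bigr => j _.
by rewrite mcoeffZ mulrnAr mulrCA.
Qed.

Section FreeAlgebra.
Variables (F : fieldType) (X : choiceType).

(* The monoid algebra of the free monoid on X, i.e. F<X>. *)
Definition free_alg := {malg F[{fmonom X}]}.

HB.instance Definition _ := GRing.Lalgebra.on free_alg.

Definition free_gen (x : X) : free_alg := << fmu x >>.

Fact free_alg_scalerAr (c : F) (x y : free_alg) : c *: (x * y) = x * (c *: y).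
Proof. exact: malg_scalerAr. Qed.

HB.instance Definition _ :=
  GRing.Lalgebra_isAlgebra.Build F free_alg free_alg_scalerAr.

Definition free_eps (x : free_alg) : F := mcoeff (@mone {fmonom X}) x.

Fact free_epsB x y : free_eps (x - y) = free_eps x - free_eps y.
Proof. exact: mcoeffB. Qed.

Fact free_epsD x y : free_eps (x + y) = free_eps x + free_eps y.
Proof. exact: mcoeffD. Qed.

Fact free_epsZ c x : free_eps (c *: x) = c * free_eps x.
Proof. exact: mcoeffZ. Qed.

Fact free_epsM x y : free_eps (x * y) = free_eps x * free_eps y.
Proof. exact: (mcoeff1g_is_multiplicative {fmonom X} F).1. Qed.

Fact free_eps1 : free_eps 1 = 1.
Proof. exact: (mcoeff1g_is_multiplicative {fmonom X} F).2. Qed.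

Fact free_eps_gen x : free_eps (free_gen x) = 0.
Proof.
rewrite /free_eps mcoeffU1; case: eqP => // /(congr1 (@fmonom_val _)).
by rewrite fmU fm1.
Qed.

End FreeAlgebra.

Definition ajt_prod (R : pzRingType) (n : nat) (a b c : 'M[R]_n) : 'M[R]_n :=
  a *m b *m c - c *m b *m a.

Fact sum_ajt_prod (F : fieldType) (n : nat) (A : lmodType F)
    (g : 'I_n -> 'I_n -> A) (i j k l m t : 'I_n) :
  \sum_p \sum_q
    ajt_prod (delta_mx i j) (delta_mx k l) (delta_mx m t) p q *: g p q =
  (kdelta j k * kdelta l m) *: g i t - (kdelta t k * kdelta l i) *: g m j.
Proof.
have dE (a b : 'I_n) (c : F) :
    \sum_p \sum_q (c *: delta_mx a b : 'M[F]_n) p q *: g p q = c *: g a b.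
  rewrite (bigD1 a) //= (bigD1 b) //= !mxE !eqxx mulr1.
  rewrite big1 ?addr0 => [|q /negPf qb]; last first.
    by rewrite !mxE qb andbF mulr0 scale0r.
  rewrite big1 ?addr0 // => p /negPf pa.
  by rewrite big1 // => q _; rewrite !mxE pa mulr0 scale0r.
have mE (a b c d e f : 'I_n) : delta_mx a b *m delta_mx c d *m delta_mx e f
    = (kdelta b c * kdelta d e : F) *: delta_mx a f :> 'M[F]_n.
  rewrite mul_delta_mx_cond -scaler_nat -scalemxAl mul_delta_mx_cond.
  by rewrite -scaler_nat scalerA.
rewrite /ajt_prod !mE -(dE i t) -(dE m j) -sumrB; apply: eq_bigr => p _.
rewrite -sumrB; apply: eq_bigr => q _.
by rewrite -scalerBl !mxE.
Qed.

Fact relator_eq0 (F : fieldType) (A : algType F) (f : A -> F)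
    (fD : {morph f : x y / x + y}) (fM : {morph f : x y / x * y})
    (fZ : forall c x, f (c *: x) = c * f x) (a b : F) (x y z u v : A) :
    f x = 0 -> f z = 0 -> f u = 0 -> f v = 0 ->
  f (x * y * z - z * y * x - a *: u + b *: v) = 0.
Proof.
move=> fx fz fu fv; rewrite -!scaleN1r !(fD, fZ, fM) fx fz fu fv.
by rewrite !(mulr0, mul0r, addr0).
Qed.

Fact relator_morph (F : fieldType) (A B : algType F) (f : {lrmorphism A -> B})
    (a b : F) (x y z u v : A) :
  f (x * y * z - z * y * x - a *: u + b *: v) =
  f x * f y * f z - f z * f y * f x - a *: f u + b *: f v.
Proof.
by rewrite rmorphD !rmorphB !rmorphM; congr (_ - _ + _); apply: linearZZ.
Qed.

Section Envelope.
Variables (F : fieldType) (n : nat).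

Local Notation FX := (free_alg F ('I_n * 'I_n)%type).
Local Notation g i j := (free_gen F (i, j)).

Definition ajt_relator (i j k l m t : 'I_n) : FX :=
  g i j * g k l * g m t - g m t * g k l * g i j
  - (kdelta j k * kdelta l m : F) *: g i t
  + (kdelta t k * kdelta l i : F) *: g m j.

Lemma ajt_relatorE (i j k l m t : 'I_n) :
  ajt_relator i j k l m t =
    g i j * g k l * g m t - g m t * g k l * g i j
    - \sum_p \sum_q
        ajt_prod (delta_mx i j) (delta_mx k l) (delta_mx m t) p q *: g p q.
Proof. by rewrite sum_ajt_prod opprB addrA addrAC. Qed.

Definition ajt_relators (x : FX) : Prop :=
  exists i j k l m t : 'I_n, x = ajt_relator i j k l m t.

Fact ajt_ideal_proper : ~ ideal_gen ajt_relators 1.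
Proof.
move=> I1.
suff: free_eps (1 : FX) = 0 by move/eqP; rewrite free_eps1 oner_eq0.
elim: I1 => [x [i [j [k [l [m [t ->]]]]]]||x y _ IHx _ IHy|a x _ IH|a x _ IH].
- apply: (relator_eq0 (@free_epsD _ _) (@free_epsM _ _) (@free_epsZ _ _));
    exact: free_eps_gen.
- by rewrite -[0](subrr 1) free_epsB subrr.
- by rewrite free_epsB IHx IHy subr0.
- by rewrite free_epsM IH mulr0.
- by rewrite free_epsM IH mul0r.
Qed.

Definition envelope : Type := quot_alg ajt_ideal_proper.

HB.instance Definition _ := GRing.Algebra.on envelope.

Definition env_gen (i j : 'I_n) : envelope := quot_pi ajt_ideal_proper (g i j).

Lemma env_gen_rel (i j k l m t : 'I_n) :
  env_gen i j * env_gen k l * env_gen m t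
  - env_gen m t * env_gen k l * env_gen i j
  - (kdelta j k * kdelta l m : F) *: env_gen i t
  + (kdelta t k * kdelta l i : F) *: env_gen m j = 0.
Proof.
apply: etrans (quot_pi_eq0 ajt_ideal_proper (IdealGen _)); last first.
  by exists i, j, k, l, m, t.
exact/esym/relator_morph.
Qed.

End Envelope.

Arguments env_gen {F n} i j.

(* Main.v *)
Require Import Defs.
From mathcomp Require Import all_boot all_algebra.

Set Implicit Arguments.
Unset Strict Implicit.
Unset Printing Implicit Defensive.

Import GRing.Theory.
Local Open Scope ring_scope.

(** The algebra is controlled by its products of two generators.  Reversing
    the first and third factors, and the second and fourth factors, of a word
    [a b c d] in either order leads to the same word [c d a b], so the two ways
    of accounting for the correction terms agree
    ([triple_commutator_exchange]).  On matrix units each correction is a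
    generator or zero, and this becomes a family of quadratic relations.  They
    say that [e i j * e k l] is governed by the two matrix products
    [E_ij E_kl] and [E_kl E_ij]: it vanishes when both do ([unit_mul_eq0]), the
    inner index can be changed when only the first is nonzero
    ([unit_mul_inner]), the outer one when only the second is
    ([unit_mul_outer]), and the remaining products [e i j * e j i] are sums of
    a function of [i] and a function of [j] ([unit_mul_diag]).

    Every identity to be shown is about a word of degree four or five.  Write
    [z] for [e o o], where [o] is the index 1.  A generator is moved across
    [z ^+ 2] with the cubic relation, at the cost of a shorter word, and then
    an index is changed so that two adjacent generators become orthogonal.
    This settles the words without a loop [p := e o j * e j o * z] or
    [q := e j o * e o j * z], where [j != o].  Here [p + q = z ^+ 3], while
    [e o j * e j o] commutes with [z] ([loop_comm]), which turns the cubic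
    relation into a second linear equation and yields [2 p = z ^+ 3 + z] and
    [2 q = z ^+ 3 - z].  This is where the halves come from; since
    [p * z ^+ 2 = p], it also gives [z ^+ 5 = z]. *)

(** * Quadratic relations from cubic ones *)

Definition triple_commutator (R : pzRingType) (a b c : R) : R :=
  a * b * c - c * b * a.

(** Both sides are [a * b * c * d - c * d * a * b]: the reversals of the odd
    and of the even positions of a word of length four commute. *)
Lemma triple_commutator_exchange (R : pzRingType) (a b c d : R) :
  triple_commutator a b c * d + c * triple_commutator b a d =
  a * triple_commutator b c d + triple_commutator a d c * b.
Proof.
by rewrite /triple_commutator !mulrBl !mulrBr !mulrA !subrKA.
Qed.

Section MatrixUnits.

(** Working in a ring without 2-torsion keeps scalars out of the computation;
    the Kronecker symbols are then integer multiples by booleans. *)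
Variables (R : pzRingType) (I : eqType) (e : I -> I -> R).
Hypothesis two_torsion_free : forall x : R, x *+ 2 = 0 -> x = 0.
Hypothesis unit_triple : forall i j k l m t,
  triple_commutator (e i j) (e k l) (e m t) =
  e i t *+ ((j == k) && (l == m)) - e m j *+ ((t == k) && (l == i)).

(** The first three units form a path, so that the leading correction is
    [e i j]; the intermediate vertices [x] and [y] are free parameters, and the
    quadratic relations come from choosing them. *)
Lemma unit_exchange i x y j k l :
  (e i j - e y x *+ ((j == x) && (y == i))) * e k l
    + e y j * (e x l *+ ((y == i) && (x == k)) - e k y *+ (l == i))
  = e i x * (e x l *+ (j == k) - e k y *+ ((l == y) && (j == x)))
    + (e i j *+ ((x == k) && (l == y)) - e y x *+ ((j == k) && (l == i)))
      * e x y.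
Proof.
have := triple_commutator_exchange (e i x) (e x y) (e y j) (e k l).
by rewrite !unit_triple !eqxx ?andbT.
Qed.

Lemma unit_mul_eq0 i j k l : j != k -> i != l -> e i j * e k l = 0.
Proof.
move=> jk il; apply: two_torsion_free.
(* With x = j and y = l the word meets itself again on the right-hand side
   with the opposite sign. *)
have := unit_exchange i j l j k l.
rewrite !eqxx (negPf jk) [l == i]eq_sym (negPf il) /= !mulr0n !mulr1n.
rewrite !subr0 sub0r mulr0 mul0r !addr0 mulrN => /eqP.
by rewrite -addr_eq0 => /eqP.
Qed.

Lemma unit_mul_inner i j x l : i != l -> e i j * e j l = e i x * e x l.
Proof.
move=> il; have := unit_exchange i x i j j l.
rewrite !eqxx ![l == i]eq_sym (negPf il) /= andbF !andbT !mulr0n !mulr1n !subr0.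
rewrite mul0r addr0 eq_sym; case: eqP => [->|_]; rewrite ?mulr1n ?mulr0n //.
by rewrite subr0 mulr0 addr0.
Qed.

Lemma unit_mul_outer i y j k : j != k -> e i j * e k i = e y j * e k y.
Proof.
move=> jk; have [->//|iy] := eqVneq i y.
have := unit_exchange i j y j k i.
rewrite !eqxx (negPf jk) [y == i]eq_sym (negPf iy) /= !mulr0n !mulr1n.
rewrite !subr0 sub0r mulr0 mul0r !addr0 mulrN => /eqP.
by rewrite subr_eq0 => /eqP.
Qed.

Lemma unit_mul_diag i y j x : i != y ->
  e i j * e j i + e y x * e x y = e i x * e x i + e y j * e j y.
Proof.
move=> iy; have := unit_exchange i x y j j i.
rewrite !eqxx [y == i]eq_sym (negPf iy) /= !andbF /= !mulr0n !mulr1n.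
rewrite !subr0 !sub0r mulrN mulNr => /eqP.
by rewrite subr_eq addrAC -subr_eq opprK => /eqP.
Qed.

Lemma unit_swap i j k l m t :
  e i j * e k l * e m t =
  e m t * e k l * e i j + (e i t *+ ((j == k) && (l == m))
                           - e m j *+ ((t == k) && (l == i))).
Proof. by rewrite -unit_triple addrC subrK. Qed.

(** * Powers of a diagonal generator *)

Variable o : I.
Local Notation z := (e o o).

Lemma col_swap_sqr i : i != o -> e i o * z ^+ 2 = z ^+ 2 * e i o + e i o.
Proof.
move=> io; rewrite expr2 mulrA unit_swap !eqxx [o == i]eq_sym (negPf io).
by rewrite /= subr0.
Qed.

Lemma row_swap_sqr j : j != o -> e o j * z ^+ 2 = z ^+ 2 * e o j - e o j.
Proof.
by move=> jo; rewrite expr2 mulrA unit_swap !eqxx (negPf jo) /= sub0r.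
Qed.

Lemma sqr_col i : i != o -> z ^+ 2 * e i o = e i o * z ^+ 2 - e i o.
Proof. by move=> io; rewrite col_swap_sqr // addrK. Qed.

Lemma sqr_row j : j != o -> z ^+ 2 * e o j = e o j * z ^+ 2 + e o j.
Proof. by move=> jo; rewrite row_swap_sqr // subrK. Qed.

Lemma diag_col_diag i : i != o -> z * e i o * z = 0.
Proof.
move=> io; rewrite -mulrA (unit_mul_inner o i io) mulrA.
by rewrite unit_mul_eq0 ?mul0r // eq_sym.
Qed.

Lemma diag_row_diag j : j != o -> z * e o j * z = 0.
Proof.
move=> jo; rewrite -mulrA (unit_mul_outer o j jo) mulrA.
by rewrite unit_mul_eq0 ?mul0r // eq_sym.
Qed.

Lemma col_cube i : i != o -> e i o * z ^+ 3 = e i o * z.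
Proof.
move=> io; rewrite exprSr mulrA col_swap_sqr // mulrDl expr2 -2!mulrA.
by rewrite (mulrA z (e i o)) diag_col_diag // mulr0 add0r.
Qed.

Lemma row_cube j : j != o -> e o j * z ^+ 3 = - (e o j * z).
Proof.
move=> jo; rewrite exprSr mulrA row_swap_sqr // mulrBl expr2 -2!mulrA.
by rewrite (mulrA z (e o j)) diag_row_diag // mulr0 sub0r.
Qed.

Lemma cube_row j : j != o -> z ^+ 3 * e o j = z * e o j.
Proof.
move=> jo; have -> : z ^+ 3 * e o j = z * (z ^+ 2 * e o j).
  by rewrite exprS mulrA.
rewrite sqr_row // mulrDr expr2 !mulrA.
by rewrite diag_row_diag // mul0r add0r.
Qed.

(** * Loops through the base index *)

Lemma loop_sum j : j != o ->
  e o j * e j o * z + e j o * e o j * z = z ^+ 3.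
Proof.
move=> jo; rewrite -mulrDl (@unit_mul_diag o j j o) 1?eq_sym // mulrDl.
by rewrite -(mulrA (e j j)) [e j j * z]unit_mul_eq0 // mulr0 addr0 exprSr.
Qed.

Lemma diag_loop_sum j : j != o ->
  z * (e o j * e j o) + z * (e j o * e o j) = z ^+ 3.
Proof.
move=> jo; rewrite -mulrDr (@unit_mul_diag o j j o) 1?eq_sym // mulrDr.
by rewrite !mulrA [z * e j j]unit_mul_eq0 1?eq_sym // mul0r addr0 exprSr.
Qed.

(** No sequence of swaps connects these two words.  Index changes do: they
    turn the left one into [e o j * e j j ^+ 2 * e j o] and the word
    [e o j * z ^+ 2 * e j o], which is the right one up to a swap, into
    [e j j ^+ 2 * e o j * e j o]; these two differ by a swap again. *)
Lemma diag_loop_diag j : j != o ->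
  z * (e o j * e j o) * z = e o j * e j o * z ^+ 2.
Proof.
move=> jo; have oj : o != j by rewrite eq_sym.
have -> : e o j * e j o * z ^+ 2 = e o j * z ^+ 2 * e j o + e o j * e j o.
  by rewrite -mulrA col_swap_sqr // mulrDr mulrA.
have -> : e o j * z ^+ 2 * e j o = e j j ^+ 2 * e o j * e j o.
  rewrite !expr2 (mulrA (e o j)) (unit_mul_outer o j jo) -!mulrA.
  by rewrite (mulrA (e o j) z) (unit_mul_outer o j jo) !mulrA.
have -> : z * (e o j * e j o) * z = e o j * e j j * e j j * e j o.
  by rewrite mulrA (unit_mul_inner o j oj) -!mulrA (unit_mul_inner o j jo).
rewrite unit_swap !eqxx [j == o](negPf jo) /= subr0 mulrDl.
by rewrite -expr2.
Qed.

Lemma sqr_loop j : j != o -> z ^+ 2 * (e o j * e j o) = e o j * e j o * z ^+ 2.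
Proof.
move=> jo; rewrite mulrA sqr_row // mulrDl -(mulrA _ (z ^+ 2)) sqr_col //.
by rewrite mulrBr subrK mulrA.
Qed.

Lemma loop_comm j : j != o -> z * (e o j * e j o) = e o j * e j o * z.
Proof.
move=> jo; have -> : z * (e o j * e j o) = z * (z ^+ 2 * (e o j * e j o)).
  by rewrite [RHS]mulrA -exprS [RHS]mulrA cube_row // mulrA.
rewrite sqr_loop // -diag_loop_diag // !mulrA -expr2 -(mulrA (z ^+ 2)).
by rewrite sqr_loop // -(mulrA _ (z ^+ 2)) -exprSr -mulrA col_cube // mulrA.
Qed.

(** The cubic relation gives the difference of the two loops at [z], up to the
    order of the factors, and commutation removes that proviso. *)
Lemma outer_loop_double j : j != o ->
  (e o j * e j o * z) *+ 2 = z ^+ 3 + z.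
Proof.
move=> jo; rewrite mulr2n -{1}loop_comm // unit_swap !eqxx.
rewrite [o == j]eq_sym (negPf jo) /= subr0 mulr1n addrA -(mulrA z).
by rewrite diag_loop_sum.
Qed.

Lemma inner_loop_double j : j != o ->
  (e j o * e o j * z) *+ 2 = z ^+ 3 - z.
Proof.
move=> jo; have /(canRL (addKr _)) -> := loop_sum jo.
rewrite mulrnDl mulNrn outer_loop_double // mulr2n opprD addrAC.
by rewrite addrA addNr add0r addrC.
Qed.

Lemma diag_pow5 j : j != o -> z ^+ 5 = z.
Proof.
move=> jo; apply: (addIr (z ^+ 3)); rewrite [RHS]addrC -(outer_loop_double jo).
have -> : z ^+ 5 + z ^+ 3 = (z ^+ 3 + z) * z ^+ 2.
  by rewrite mulrDl -exprD -exprS.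
by rewrite -(outer_loop_double jo) mulrnAl -2!mulrA -exprS col_cube // mulrA.
Qed.

(** * The three families of products *)

Lemma unit_mul_row_diag_col_neq i j k l : l != o -> i != k ->
  e i j * (e o k * z * e l o) = 0.
Proof.
move=> lo ik; have [->|jo] := eqVneq j o; last first.
  by rewrite !mulrA (unit_mul_eq0 jo ik) !mul0r.
have [io|io] := eqVneq i o.
  rewrite io in ik *; rewrite eq_sym in ik.
  by rewrite !mulrA diag_row_diag // mul0r.
rewrite unit_swap !eqxx [o == l]eq_sym (negPf lo) andbF /= sub0r mulr1n mulrBr.
by rewrite !mulrA !unit_mul_eq0 ?mul0r ?subr0 // eq_sym.
Qed.

Lemma unit_mul_row_diag_col_base k l : l != o ->
  e k o * (e o k * z * e l o) = - (z * e l o).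
Proof.
move=> lo; rewrite unit_swap !eqxx [o == l]eq_sym (negPf lo) andbF /= sub0r.
rewrite mulr1n mulrBr (unit_mul_outer k o) 1?eq_sym // !mulrA.
have [->|ko] := eqVneq k o; first by rewrite diag_col_diag // mul0r sub0r.
by rewrite [e k o * e l o]unit_mul_eq0 ?mul0r ?sub0r // eq_sym.
Qed.

Lemma unit_mul_row_diag_col j k l : l != o -> j != o ->
  e k j * (e o k * z * e l o) =
  - (e o j * e l o) + (e o j * e j o * z ^+ 2) *+ (j == l).
Proof.
move=> lo jo; have -> : e k j * (e o k * z * e l o)
    = e o j * (z ^+ 2 * e l o).
  by rewrite !mulrA (unit_mul_outer k o jo) -!mulrA.
rewrite sqr_col // mulrBr addrC; congr (_ + _).
have [->|jl] := eqVneq j l; first by rewrite mulrA.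
by rewrite mulrA (unit_mul_outer o l jl) expr2 -!mulrA
  (mulrA (e l l)) unit_mul_eq0 // mul0r mulr0.
Qed.

Lemma diag_mul_sqr_row k : k != o -> z * (z ^+ 2 * e o k) = z * e o k.
Proof. by move=> ko; rewrite mulrA -exprS cube_row. Qed.

Lemma col_mul_sqr_row i k : i != o -> k != i ->
  e i o * (z ^+ 2 * e o k) = e i o * e o k.
Proof.
move=> io ki; have [->|ko] := eqVneq k o; first by rewrite -exprSr col_cube.
rewrite sqr_row // mulrDr mulrA.
rewrite (unit_mul_inner o i) 1?eq_sym // expr2 -!mulrA (mulrA (e i k)).
by rewrite unit_mul_eq0 // mul0r mulr0 add0r.
Qed.

Lemma col_mul_sqr_row_loop i : i != o ->
  e i o * (z ^+ 2 * e o i) = e i o * e o i * z ^+ 2 + e i o * e o i.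
Proof.
move=> io; rewrite sqr_row // mulrDr.
by rewrite mulrA.
Qed.

Lemma row_mul_sqr_row j k : j != o -> k != o -> e o j * (z ^+ 2 * e o k) = 0.
Proof.
move=> jo ko; rewrite expr2 -mulrA (unit_mul_inner o k) 1?eq_sym //.
rewrite !mulrA (unit_mul_outer o j) // -(mulrA (e j j)).
by rewrite [e o j * e o k]unit_mul_eq0 ?(eq_sym o) // mulr0 mul0r.
Qed.

End MatrixUnits.

(** * The envelope *)

Lemma env_gen_triple (F : fieldType) (n : nat) (i j k l m t : 'I_n) :
  triple_commutator (env_gen i j) (env_gen k l) (env_gen m t) =
  env_gen i t *+ ((j == k) && (l == m)) - env_gen m j *+ ((t == k) && (l == i))
  :> envelope F n.
Proof.
apply/eqP; rewrite -subr_eq0 opprB addrA addrAC -(env_gen_rel F i j k l m t).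
by rewrite /triple_commutator /kdelta -!natrM !mulnb !scaler_nat.
Qed.

Lemma double_eq0 (F : fieldType) (V : lmodType F) (x : V) :
  2%:R != 0 :> F -> x *+ 2 = 0 -> x = 0.
Proof.
move=> nz2 /eqP; rewrite -scaler_nat scaler_eq0 (negPf nz2).
exact: eqP.
Qed.

Lemma half_double (F : fieldType) (V : lmodType F) (x y : V) :
  2%:R != 0 :> F -> x *+ 2 = y -> x = 2^-1 *: y.
Proof. by move=> nz2 <-; rewrite -scaler_nat scalerA mulVf // scale1r. Qed.

(** Only the cubic relation matters, so the identities hold in the image of
    every representation of the triple system.  The index [two] supplies the
    loop from which the fifth power of [e one one] is computed. *)
Lemma unit_family_products (F : fieldType) (A : algType F) (n : nat)
    (e : 'I_n -> 'I_n -> A) (one two : 'I_n) :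
  2%:R != 0 :> F -> two != one ->
  (forall i j k l m t, triple_commutator (e i j) (e k l) (e m t) =
     e i t *+ ((j == k) && (l == m)) - e m j *+ ((t == k) && (l == i))) ->
  forall i j k l : 'I_n,
  [/\ l != one ->
        e i j * (e one k * e one one * e l one) =
        kdelta i k *: (- (e one j * e l one)
          + (kdeltac j one * kdelta j l * 2^-1) *: (e one one ^+ 4 + e one one ^+ 2)),
      e i j * (e one one ^+ 2 * e one k) =
        kdelta j one *:
          (kdelta i one *: (kdelta k one *: e one one ^+ 4
                          + kdeltac k one *: (e one one * e one k))
           + kdeltac i one *: ((kdelta i k * 2^-1) *: (e one one ^+ 4 - e one one ^+ 2)
                             + e i one * e one k))
        - (kdeltac j one * kdelta i one * kdelta k one) *: (e one j * e one one)
    & e i j * e one one ^+ 4 =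
        kdelta j one *:
          (kdelta i one *: e one one
           + kdeltac i one *: (e one one ^+ 2 * e i one + e i one))
        - (kdeltac j one * kdelta i one) *: (e one one ^+ 2 * e one j - e one j)].
Proof.
move=> nz2 two_one tr i j k l.
have tf (x : A) : x *+ 2 = 0 -> x = 0 by exact: double_eq0.
rewrite /kdeltac /kdelta; split=> [lo||].
- have [<-{k}|ik] := eqVneq i k; last first.
    by rewrite scale0r (unit_mul_row_diag_col_neq tf tr).
  rewrite scale1r; have [->|jo] := eqVneq j one.
    by rewrite subrr !mul0r scale0r addr0 (unit_mul_row_diag_col_base tf tr).
  rewrite (unit_mul_row_diag_col tf tr) // subr0 mul1r; congr (_ + _).
  have [_|_] := eqVneq j l; last by rewrite mul0r scale0r mulr0n.
  rewrite mul1r mulr1n; apply: half_double => //.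
  by rewrite expr2 mulrA -mulrnAl (outer_loop_double tf tr) // mulrDl -exprSr.
- have [->|jo] := eqVneq j one; last first.
    rewrite scale0r sub0r subr0 mul1r -natrM mulnb scaler_nat.
    have [->|io] := eqVneq i one; last first.
      by rewrite mulrA expr2 mulrA (unit_mul_eq0 tf tr) // !mul0r oppr0.
    have [->|ko] := eqVneq k one; last first.
      by rewrite (row_mul_sqr_row tf tr) // oppr0.
    by rewrite -exprSr (row_cube tf tr).
  rewrite subrr !mul0r scale0r subr0 scale1r.
  have [->|io] := eqVneq i one.
    rewrite subrr scale0r addr0 scale1r.
    have [->|ko] := eqVneq k one.
      by rewrite subrr scale0r addr0 scale1r -exprSr -exprS.
    by rewrite scale0r add0r subr0 scale1r (diag_mul_sqr_row tf tr).
  rewrite scale0r add0r subr0 scale1r.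
  have [<-|ik] := eqVneq i k; last first.
    by rewrite mul0r scale0r add0r (col_mul_sqr_row tf tr) // eq_sym.
  rewrite (col_mul_sqr_row_loop tr) // mul1r; congr (_ + _).
  apply: half_double => //.
  by rewrite expr2 mulrA -mulrnAl (inner_loop_double tf tr) // mulrBl -exprSr.
- have [->|jo] := eqVneq j one; last first.
    rewrite scale0r sub0r subr0 mul1r scaler_nat.
    have [->|io] := eqVneq i one; last first.
      by rewrite expr2 (mulrA (e i j)) (unit_mul_eq0 tf tr) // !mul0r oppr0.
    rewrite mulr1n exprSr mulrA (row_cube tf tr) // mulNr -mulrA -expr2.
    by rewrite (row_swap_sqr tr).
  rewrite subrr !mul0r scale0r subr0 scale1r.
  have [->|io] := eqVneq i one.
    rewrite subrr scale0r addr0 scale1r -exprS.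
    by apply: (diag_pow5 tf tr two_one).
  rewrite scale0r add0r subr0 scale1r exprSr mulrA (col_cube tf tr) //.
  by rewrite -mulrA -expr2 (col_swap_sqr tr).
Qed.

Theorem proposition4p3 (F : closedFieldType) (hF : [pchar F] =i pred0)
    (n : nat) (hn : (2 <= n)%N) :
  let one : 'I_n := Ordinal (ltnW hn) in
  let e : 'I_n -> 'I_n -> envelope F n := env_gen in
  forall i j k l : 'I_n,
  [/\ l != one ->
        e i j * (e one k * e one one * e l one) =
        kdelta i k *: (- (e one j * e l one)
          + (kdeltac j one * kdelta j l * 2^-1) *: (e one one ^+ 4 + e one one ^+ 2)),
      e i j * (e one one ^+ 2 * e one k) =
        kdelta j one *:
          (kdelta i one *: (kdelta k one *: e one one ^+ 4
                          + kdeltac k one *: (e one one * e one k))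
           + kdeltac i one *: ((kdelta i k * 2^-1) *: (e one one ^+ 4 - e one one ^+ 2)
                             + e i one * e one k))
        - (kdeltac j one * kdelta i one * kdelta k one) *: (e one j * e one one)
    & e i j * e one one ^+ 4 =
        kdelta j one *:
          (kdelta i one *: e one one
           + kdeltac i one *: (e one one ^+ 2 * e i one + e i one))
        - (kdeltac j one * kdelta i one) *: (e one one ^+ 2 * e one j - e one j)].
Proof.
move=> one e; apply: (unit_family_products (two := Ordinal hn)) => //.
  by have := hF 2%N; rewrite !inE /= => ->.
exact: env_gen_triple.
Qed.
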